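(* For $n\geq 1$, the number of permutations $\pi\in\mathcal{S}_n$ such that $\pi^3$ is the decreasing permutation $n(n-1)\cdots 21$ equals \[\sum_{i=0}^{\lfloor\frac{n}{6}\rfloor}\binom{\lfloor\frac{n}{2}\rfloor}{3i}\frac{(3i)!}{i!\,3^i}\cdot 4^i.\]
   Context: $\mathcal{S}_n$ is the symmetric group on $[n]$, permutations written in one-line notation; $\pi^3=\pi\circ\pi\circ\pi$. The decreasing permutation is $i\mapsto n+1-i$. *)

(* Defs.v *)
From mathcomp Require Import all_boot all_order all_algebra all_fingroup.

Set Implicit Arguments.
Unset Strict Implicit.
Unset Printing Implicit Defensive.

(* [n] is modelled by 'I_n = {0, ..., n-1}: the map i |-> n+1-i on [n] becomes
   i |-> n-1-i, which is rev_ord. *)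
Definition decreasing_perm (n : nat) : 'S_n := perm (@rev_ord_inj n).

(* Main.v *)
(* Let w be the decreasing permutation. A cube root s of w commutes with w, and
   t = s w satisfies t^3 = 1; conversely, t w is a cube root of w whenever
   t^3 = 1 and t commutes with w. So one counts the t of order dividing 3 in the
   centralizer of w, all of which fix the fixed point of w, if any. On m orbits
   of size 2, look at a point x: either t fixes x and w x, or (x, t x, t^2 x)
   lies in three distinct orbits and t is determined on all of them. This gives
   a(m+1) = a(m) + 4 m (m-1) a(m-2), which the sum, written with falling
   factorials as \sum_i m^_(3i) (4/3)^i / i!, satisfies term by term. *)
Require Import Defs.
From mathcomp Require Import all_boot all_order all_algebra all_fingroup.
From mathcomp Require Import zify ring.

Set Implicit Arguments.
Unset Strict Implicit.
Unset Printing Implicit Defensive.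

Import GRing.Theory.
Local Open Scope ring_scope.

(** * Cube roots of unity commuting with an involution [w], by support *)

Section CubeRootsOfUnity.
Local Open Scope group_scope.
Variables (T : finType) (w : {perm T}).
Hypothesis wK : involutive w.

Definition cube1_on (D : {set T}) :=
  [set t : {perm T} | [&& perm_on D t, t * w == w * t & t ^+ 3 == 1]].

Definition free_stable (D : {set T}) :=
  forall u, u \in D -> w u \in D /\ w u != u.

Lemma cube1_onP (D : {set T}) t :
  reflect [/\ perm_on D t, commute t w & t ^+ 3 = 1] (t \in cube1_on D).
Proof.
rewrite inE; apply: (iffP and3P) => [[H /eqP ? /eqP ?]|[H cw t3]].
  by split.
by split=> //; apply/eqP.
Qed.

(** The bijection is [t |-> c^-1 * t]. Agreement with [c] on [S] makes [c^-1 * t] fix [S] pointwise,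
    so its support is disjoint from that of [c]; the two commute, and cubes multiply. *)
Lemma card_cube1_agree (D S : {set T}) c :
  S \subset D -> c \in cube1_on S ->
  #|[set t in cube1_on D | [forall u in S, t u == c u]]| = #|cube1_on (D :\: S)|.
Proof.
move=> sSD /cube1_onP[cS cw c3]; rewrite -(card_lcoset (cube1_on (D :\: S)) c).
have dis : [disjoint S & D :\: S].
  by rewrite -setI_eq0; apply/eqP/setP => u; rewrite !inE; case: (u \in S).
have commC t' : perm_on (D :\: S) t' -> commute c t'.
  by move=> H; exact: perm_onC cS H dis.
apply: eq_card => t; rewrite mem_lcoset inE.
apply/andP/cube1_onP => [[/cube1_onP[tD tw t3] /forall_inP agr]|[tDS tw t3]].
  have DS : perm_on (D :\: S) (c^-1 * t).
    apply/subsetP => u; rewrite inE permM => ne.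
    have uS : u \notin S.
      apply/negP => uS; move/eqP: ne; apply.
      have cuS : c^-1 u \in S by rewrite (perm_closed _ (perm_onV cS)).
      by rewrite (eqP (agr _ cuS)) permKV.
    rewrite inE uS /=; apply: contraNT ne => uD.
    by rewrite (out_perm (perm_onV cS) uS) (out_perm tD uD).
  split=> //.
    apply/commute_sym/commuteM; last exact/commute_sym.
    exact/commuteV/commute_sym.
  have := expgMn 3 (commC _ DS); rewrite mulKVg t3 c3 mul1g; exact: esym.
rewrite -(mulKVg c t); set t' := c^-1 * t in tDS tw t3 *.
split; last first.
  apply/forall_inP => u uS; rewrite permM; apply/eqP; apply: (out_perm tDS).
  by rewrite inE (perm_closed _ cS) uS.
apply/cube1_onP; split.
- apply: perm_onM; first exact: (subset_trans cS).
  exact: (subset_trans tDS (subsetDl _ _)).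
- by apply/commute_sym/commuteM; apply/commute_sym.
- by rewrite (expgMn 3 (commC _ tDS)) c3 t3 mulg1.
Qed.

Definition orb2 (x : T) : {set T} := [set x; w x].

Lemma orb2_disj x y : y \notin orb2 x -> w y \notin orb2 x.
Proof.
rewrite !inE !negb_or => /andP[yx ywx].
rewrite (inj_eq perm_inj) yx andbT; apply: contraNneq ywx => <-.
by rewrite wK.
Qed.

Lemma card_orb2 (D : {set T}) x : free_stable D -> x \in D -> #|orb2 x| = 2%N.
Proof. by move=> fD /fD[_ ne]; rewrite cards2 eq_sym ne. Qed.

Lemma free_stableD1 (D : {set T}) x :
  free_stable D -> free_stable (D :\: orb2 x).
Proof.
move=> fD u; rewrite in_setD => /andP[ux /fD[wuD ->]].
by rewrite in_setD orb2_disj.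
Qed.

Lemma cardD_orb2 (D : {set T}) x : free_stable D -> x \in D ->
  #|D :\: orb2 x| = (#|D| - 2)%N.
Proof.
move=> fD xD; rewrite cardsD -(card_orb2 fD xD).
have /setIidPr-> // : orb2 x \subset D.
by apply/subsetP => u; rewrite !inE => /orP[]/eqP-> //; case: (fD _ xD).
Qed.

Lemma three_cycle x y z : x != y -> x != z -> y != z ->
  exists r : {perm T}, [/\ perm_on [set x; y; z] r, r ^+ 3 = 1,
    r x = y, r y = z & r z = x].
Proof.
(* Products act from left to right, so [r] sends [x] to [y], [y] to [z] and [z] to [x]. *)
move=> xy xz yz; pose r := tperm x y * tperm x z.
have rx : r x = y by rewrite permM tpermL tpermD // eq_sym.
have ry : r y = z by rewrite permM tpermR tpermL.
have rz : r z = x by rewrite permM (@tpermD _ x y) ?tpermR // eq_sym.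
have rS : perm_on [set x; y; z] r.
  apply/subsetP => u; rewrite !inE; apply: contraNT; rewrite !negb_or.
  by case/andP=> /andP[ux uy] uz; rewrite permM !tpermD // eq_sym.
exists r; split=> //; clearbody r; apply/permP => u.
rewrite !expgS expg0 mulg1 !permM perm1.
case uS: (u \in [set x; y; z]).
  by move: uS; rewrite !inE => /orP[/orP[]|] /eqP->; rewrite !(rx, ry, rz).
by rewrite !(out_perm rS) ?uS.
Qed.

(** The witness is [r * r ^ w], with [r] the 3-cycle through [x], [y], [z]: its conjugate is the
    3-cycle through [w x], [w y], [w z], disjoint from [r]. *)
Lemma cube1_lift x y z :
  w x != x -> w y != y -> w z != z ->
  y \notin orb2 x -> z \notin orb2 x -> z \notin orb2 y ->
  exists2 c, c \in cube1_on (orb2 x :|: orb2 y :|: orb2 z) &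
    [/\ c x = y, c y = z & c z = x].
Proof.
move=> wx wy wz yx zx zy.
have := orb2_disj yx; have := orb2_disj zx; have := orb2_disj zy.
move: yx zx zy; rewrite !inE !(inj_eq perm_inj) !negb_or.
move=> /andP[yx ywx] /andP[zx zwx] /andP[zy zwy].
move=> /andP[wzy _] /andP[wzx _] /andP[wyx _].
have [r [rS r3 rx ry rz]] : exists r : {perm T},
    [/\ perm_on [set x; y; z] r, r ^+ 3 = 1, r x = y, r y = z & r z = x].
  by apply: three_cycle; rewrite eq_sym.
have rwS : perm_on [set w x; w y; w z] (r ^ w).
  apply/subsetP => u; rewrite inE -{1 2}(wK u) permJ (inj_eq perm_inj) => ne.
  have : w u \in [set x; y; z] by apply: contraR ne => /(out_perm rS)->.
  by rewrite !inE -!(inj_eq (@perm_inj _ w) (w u)) wK.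
have dis : [disjoint [set x; y; z] & [set w x; w y; w z]].
  have sw a b : (a == w b) = (b == w a).
    by rewrite -(inj_eq (@perm_inj _ w)) wK eq_sym.
  rewrite disjoints_subset; apply/subsetP => u; rewrite !inE !negb_or.
  case/orP=> [/orP[]|] /eqP->.
  - by rewrite eq_sym wx sw ywx sw zwx.
  - by rewrite ywx eq_sym wy sw zwy.
  - by rewrite zwx zwy eq_sym wz.
have cr : commute r (r ^ w) := perm_onC rS rwS dis.
have fix_rw u : u \in [set x; y; z] -> (r ^ w) u = u.
  by move=> uS; apply: (out_perm rwS); rewrite (disjointFr dis uS).
exists (r * r ^ w).
  apply/cube1_onP; split.
  - apply: perm_onM; [apply: subset_trans rS _|apply: subset_trans rwS _];
      by apply/subsetP => u; rewrite !inE => /orP[/orP[]|] ->; rewrite ?orbT.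
  (* Since [w * w = 1], conjugation by [w] swaps the two commuting factors and hence fixes their
     product. *)
  - apply/commgP/conjg_fixP; rewrite conjMg -conjgM.
    suff -> : w * w = 1 by rewrite conjg1 -cr.
    by apply/permP => u; rewrite permM perm1 wK.
  - by rewrite (expgMn 3 cr) -conjXg r3 conj1g mulg1.
by split; rewrite permM ?rx ?ry ?rz fix_rw // !inE eqxx ?orbT.
Qed.

Lemma cube1K (D : {set T}) t u : t \in cube1_on D -> t (t (t u)) = u.
Proof.
by case/cube1_onP=> _ _ t3; rewrite -[RHS]perm1 -t3 !expgS expg0 mulg1 !permM.
Qed.

Lemma cube1_comm (D : {set T}) t u : t \in cube1_on D -> t (w u) = w (t u).
Proof. by case/cube1_onP=> _ tw _; rewrite -!permM tw. Qed.

(** If [t x = w x], then applying [t] twice more gives [t (t (t x)) = w x], contradicting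
    [t ^+ 3 = 1]. The cases [t (t x) = x] and [t (t x) = w x] reduce to [t x = x] and [t x = w x]
    after one more application of [t]. *)
Lemma cube1_on_orbit (D : {set T}) t x :
  free_stable D -> t \in cube1_on D -> x \in D -> t x != x ->
  (t x \in D :\: orb2 x) && (t (t x) \in D :\: orb2 x :\: orb2 (t x)).
Proof.
move=> fD tA xD nx; have [tD _ _] := cube1_onP _ _ tA.
have t3x := cube1K x tA; have twE u := cube1_comm u tA.
have nwx : t x != w x.
  apply/eqP => e; have := t3x; rewrite e twE e wK e => ewx.
  by case: (fD _ xD); rewrite ewx eqxx.
have n1 : t (t x) != x by apply: contraNneq nx => e; rewrite -{1}e t3x.
have n2 : t (t x) != w x.
  apply: contraNneq nwx => e; apply/eqP/(can_inj wK).
  by rewrite wK -twE -e t3x.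
rewrite !inE !(perm_closed _ tD) xD -twE !(inj_eq perm_inj) !negb_or nx nwx.
by rewrite n1 n2.
Qed.

Lemma card_cube1_rec (D : {set T}) x : free_stable D -> x \in D ->
  #|cube1_on D| = (#|cube1_on (D :\: orb2 x)| +
    \sum_(y in D :\: orb2 x) \sum_(z in D :\: orb2 x :\: orb2 y)
       #|cube1_on (D :\: orb2 x :\: orb2 y :\: orb2 z)|)%N.
Proof.
move=> fD xD; have [_ wx] := fD _ xD.
have orbD u : u \in D -> orb2 u \subset D.
  move=> uD; apply/subsetP => v; rewrite !inE => /orP[]/eqP-> //.
  by case: (fD _ uD).
rewrite -sum1_card (bigID (fun t : {perm T} => t x == x)) /=; congr addn.
  (* Fixing [x] amounts to agreeing with the identity on the orbit of [x]. *)
  rewrite sum1dep_card -(@card_cube1_agree _ (orb2 x) 1) ?orbD //; last first.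
    apply/cube1_onP; split; [exact: perm_on1|exact/commute_sym/commute1|].
    exact: expg1n.
  apply: eq_card => t; rewrite [LHS]in_set [RHS]in_set.
  apply: andb_id2l => tA; apply/eqP/forall_inP => [tx u|]; last first.
    by move/(_ x); rewrite perm1 !inE eqxx => /(_ isT)/eqP.
  rewrite perm1 !inE => /orP[]/eqP->; first exact/eqP.
  by rewrite (cube1_comm _ tA) tx.
rewrite (partition_big (fun t : {perm T} => t x)
  (mem (D :\: orb2 x))) /=; last first.
  by move=> t /andP[tA nx]; case/andP: (cube1_on_orbit fD tA xD nx).
apply: eq_bigr => y yD'.
rewrite (partition_big (fun t : {perm T} => t y)
  (mem (D :\: orb2 x :\: orb2 y))) /=; last first.
  move=> t /andP[/andP[tA nx] /eqP<-].
  by case/andP: (cube1_on_orbit fD tA xD nx).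
apply: eq_bigr => z zD'; rewrite sum1dep_card.
have /setDP[yD yx] := yD'; have /setDP[/setDP[zD zx] zy] := zD'.
have [c cA [cx cy cz]] := cube1_lift wx (fD _ yD).2 (fD _ zD).2 yx zx zy.
have sSD : orb2 x :|: orb2 y :|: orb2 z \subset D.
  by apply/subUsetP; split; [apply/subUsetP; split|]; apply: orbD.
rewrite !setDDl setUA -(card_cube1_agree sSD cA).
(* The values at [x] and [y] force [t z = x], and commutation with [w] then forces those at [w x],
   [w y], [w z]. *)
apply: eq_card => t; rewrite [LHS]in_set [RHS]in_set -!andbA.
apply: andb_id2l => tA; apply/and3P/forall_inP => [[_ /eqP tx /eqP ty] u|agr].
  have tz : t z = x. by rewrite -ty -tx (cube1K _ tA).
  rewrite !inE => /orP[/orP[]|]/orP[]/eqP->;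
    by rewrite ?(cube1_comm _ tA) ?(cube1_comm _ cA) ?tx ?ty ?tz ?cx ?cy ?cz.
have tx : t x = y by rewrite -cx; apply/eqP/agr; rewrite !inE eqxx.
have ty : t y = z by rewrite -cy; apply/eqP/agr; rewrite !inE eqxx ?orbT.
split; rewrite ?tx ?ty //.
by move: yx; rewrite !inE negb_or => /andP[].
Qed.

Lemma cube1_on0 : cube1_on set0 = [set 1].
Proof.
apply/setP => t; rewrite in_set1; apply/cube1_onP/eqP => [[t0 _ _]|->].
  by apply/permP => u; rewrite perm1 (out_perm t0) ?inE.
by split; [exact: perm_on1 | exact/commute_sym/commute1 | exact: expg1n].
Qed.

End CubeRootsOfUnity.

(** * The summands, their recurrence and the count on [m] orbits *)

Definition cube1_term (m i : nat) : rat :=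
  (m ^_ (3 * i))%:R * (4 / 3) ^+ i / (i`!)%:R.

(** Pascal's rule for falling factorials at [k.+1 = 3 * i.+1]: the factor [3 * i.+1] meets
    [(4 / 3) / i.+1] and leaves 4. For [m < 2] the truncated [m.-2] is harmless, as
    [m * m.-1 = 0]. *)
Lemma cube1_term_rec m i :
  cube1_term m.+1 i.+1 =
  cube1_term m i.+1 + 4 * (m * m.-1)%:R * cube1_term m.-2 i.
Proof.
have ffS k : (m.+1 ^_ k.+1 = m ^_ k.+1 + k.+1 * m ^_ k)%N.
  rewrite ffactSS ffactnSr [(m ^_ k * _)%N]mulnC -mulnDl.
  case: (leqP k m) => [km|mk]; last by rewrite ffact_small // !muln0.
  by congr muln; lia.
rewrite /cube1_term (_ : 3 * i.+1 = (3 * i).+3)%N; last by lia.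
rewrite ffS (_ : m ^_ (3 * i).+2 = m * m.-1 * m.-2 ^_ (3 * i))%N; last first.
  by rewrite !ffactnS mulnA.
rewrite factS (_ : (3 * i).+3 = 3 * i.+1)%N; last by lia.
rewrite natrD !natrM exprS.
have f0 : (i`!)%:R != 0 :> rat by rewrite Num.Theory.pnatr_eq0 -lt0n fact_gt0.
have i0 : i.+1%:R != 0 :> rat by rewrite Num.Theory.pnatr_eq0.
by field; rewrite f0 /= -[1 + _]mulrS.
Qed.

(** Terms with [3 * i > m] vanish, so the cutoff [N] can be left free; the induction uses it at
    [N.+1] for [m] orbits and at [N] for [m.-2]. *)
Lemma card_cube1 (T : finType) (w : {perm T}) (D : {set T}) m N :
  involutive w -> free_stable w D -> #|D| = (2 * m)%N -> (m < 3 * N)%N ->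
  (#|cube1_on w D|)%:R = \sum_(0 <= i < N) cube1_term m i.
Proof.
move=> wK; elim/ltn_ind: m N D => m IH [|N] D fD cD mN.
  by rewrite muln0 in mN.
case: m => [|m] in IH cD mN *.
  move/eqP: cD; rewrite muln0 cards_eq0 => /eqP->.
  rewrite cube1_on0 cards1 big_nat_recl // big1 => [|i _].
    by rewrite /cube1_term muln0 ffactn0 fact0 !mul1r invr1 addr0.
  by rewrite /cube1_term mulnS ffact_small // !mul0r.
have /card_gt0P[x xD] : (0 < #|D|)%N by rewrite cD; lia.
have fDx := free_stableD1 (x := x) wK fD.
have cDx : #|D :\: orb2 w x| = (2 * m)%N by rewrite cardD_orb2 // cD; lia.
rewrite (card_cube1_rec wK fD xD) natrD (IH m _ N.+1) //; last by lia.
rewrite big_nat_recl // [RHS]big_nat_recl // -addrA; congr (_ + _).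
rewrite (eq_bigr _ (fun i _ => cube1_term_rec m i)) big_split /= -mulr_sumr.
congr (_ + _).
have cDxy y : y \in D :\: orb2 w x ->
    #|D :\: orb2 w x :\: orb2 w y| = (2 * m.-1)%N.
  by move=> yD; rewrite cardD_orb2 // cDx; lia.
set F := \sum_(0 <= i < N) _.
have E y z : y \in D :\: orb2 w x -> z \in D :\: orb2 w x :\: orb2 w y ->
    (#|cube1_on w (D :\: orb2 w x :\: orb2 w y :\: orb2 w z)|)%:R = F.
  move=> yD zD; have fDy := free_stableD1 (x := y) wK fDx.
  (* The existence of [z] ensures that removing two more orbits really leaves [m.-2] of them. *)
  have m2 : (1 < m)%N.
    have : (0 < #|D :\: orb2 w x :\: orb2 w y|)%N by apply/card_gt0P; exists z.
    by rewrite cDxy //; lia.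
  apply: IH; [lia | exact: free_stableD1 | | lia].
  by rewrite cardD_orb2 // cDxy //; lia.
(* The [2 * m] choices of [y] and [2 * m.-1] choices of [z] give the coefficient
   [4 * (m * m.-1)]. *)
rewrite natr_sum (eq_bigr (fun=> (2 * m.-1)%:R * F)) => [|y yD].
  by rewrite sumr_const cDx -mulr_natl !natrM; ring.
rewrite natr_sum (eq_bigr (fun=> F)) => [|z zD]; last exact: E.
by rewrite sumr_const cDxy // mulr_natl.
Qed.

(** * Cube roots of the decreasing permutation *)

Theorem theorem5p2 (n : nat) (hn : (1 <= n)%N) :
  #|[set s : 'S_n | (s ^+ 3)%g == decreasing_perm n]|%:R =
  \sum_(0 <= i < (n %/ 6).+1)
     'C(n %/ 2, 3 * i)%:R * (((3 * i)`!)%:R / ((i`!)%:R * 3 ^+ i)) * 4 ^+ i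
  :> rat.
Proof.
set w := decreasing_perm n.
have wE i : w i = rev_ord i by rewrite permE.
have wK : involutive w by move=> i; rewrite !wE rev_ordK.
have w2 : (w * w = 1)%g by apply/permP => i; rewrite permM perm1 wK.
have w3 : (w ^+ 3 = w)%g by rewrite !expgS expg0 mulg1 w2 mulg1.
pose D : {set 'I_n} := [set i | w i != i].
have fD : free_stable w D.
  by move=> i; rewrite !inE (inj_eq perm_inj) => ->.
have fixE i : (i \notin D) = (i.*2.+1 == n).
  rewrite inE negbK wE -(inj_eq val_inj) /=; have := ltn_ord i.
  by move=> lt_in; apply/eqP/eqP; lia.
have cD : #|D| = (2 * (n %/ 2))%N.
  have := cardsC D; rewrite card_ord.
  case nodd: (odd n).
    have lt_n2 : (n %/ 2 < n)%N by lia.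
    have -> : ~: D = [set Ordinal lt_n2].
      apply/setP => i; rewrite inE fixE in_set1 -(inj_eq val_inj) /=.
      by apply/eqP/eqP; lia.
    by rewrite cards1; lia.
  have -> : ~: D = set0.
    by apply/setP => i; rewrite in_setC fixE in_set0; apply/eqP; lia.
  by rewrite cards0; lia.
have cs : #|[set s : 'S_n | (s ^+ 3)%g == w]| = #|cube1_on w D|.
  (* The cube roots of [w] form a right coset, by [s = (s * w) * w]. *)
  have -> : [set s : 'S_n | (s ^+ 3)%g == w] = (cube1_on w D :* w)%g.
    apply/setP => s; rewrite inE mem_rcoset.
    have wV : (w^-1 = w)%g by rewrite -[RHS]mul1g -(mulVg w) -mulgA w2 mulg1.
    rewrite wV; apply/eqP/cube1_onP => [s3|[_ sw s3]].
      have sw : commute s w by rewrite -s3; exact/commuteX/commute_refl.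
      have sww : commute (s * w)%g w by exact/commute_sym/commuteM.
      split=> //; last by rewrite (expgMn 3 sw) s3 w3 w2.
      apply/subsetP => i; rewrite inE /=; apply: contraR => iD.
      (* Commuting with [w], [s] preserves its fixed points; there is at most one, the solution of
         [i.*2.+1 = n], so [s] fixes it. *)
      have siD : s i \notin D.
        move: iD; rewrite !inE !negbK -permM sw permM => /eqP->; exact: eqxx.
      have /eqP wi : w i == i by move: iD; rewrite inE negbK.
      rewrite sw permM wi; apply/eqP/val_inj.
      by move: iD siD; rewrite !fixE /= => /eqP i2 /eqP; lia.
    have ws : s = (s * w * w)%g by rewrite -mulgA w2 mulg1.
    by rewrite ws (expgMn 3 sw) s3 mul1g w3.
  exact: card_rcoset.
(* This cutoff suffices because [n %/ 6] is the integer part of [(n %/ 2) / 3]. *)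
rewrite cs (card_cube1 (N := (n %/ 6).+1) wK fD cD); last by lia.
apply: eq_bigr => i _; rewrite /cube1_term -bin_ffact natrM expr_div_n.
by rewrite invfM; ring.
Qed.
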